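(* Let $k$ be a field of characteristic $p>0$. Then: (a) For any polynomial $P(z)\in k[z]$ (not necessarily homogeneous nor HN) of degree $d\ge1$, $\Delta^mP^{m+1}=0$ for any $m\ge\frac{d(p-1)}{2}$. (b) For any HN formal power series $P(z)\in k[[z]]$, i.e. such that $\Delta^mP^m=0$ for any $m\ge1$, we have $\Delta^mP^{m+1}=0$ for any $m\ge p-1$.
   Context: $z=(z_1,\dots,z_n)$ are free commuting variables, $k[z]$ and $k[[z]]$ are the algebras of polynomials and of formal power series in $z$ over $k$, and $\Delta=\sum_{i=1}^n\partial^2/\partial z_i^2$ is the Laplace operator; $m$ denotes an integer, and $\Delta^mP^{m+1}$ means $\Delta^m$ applied to the power $P^{m+1}$. Over a field of positive characteristic, ''HN'' (Hessian nilpotent) here means $\Delta^mP^m=0$ for all $m\ge1$.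
   Formalization: In (a) the single case d = 1, p = 3, m = 1 is excluded, because the claim fails there: for P = z_1 in characteristic 3 one has m = d(p-1)/2 = 1 but ΔP^2 = 2 ≠ 0. *)

(* Defs.v *)
From HB Require Import structures.
From mathcomp Require Import all_boot all_order all_algebra.
From mathcomp Require Import mpoly boolp.

Set Implicit Arguments.
Unset Strict Implicit.
Unset Printing Implicit Defensive.

Import GRing.Theory.

Local Open Scope ring_scope.

Definition mlaplace (n : nat) (R : comNzRingType) (P : {mpoly R[n]}) :
    {mpoly R[n]} :=
  \sum_(i < n) (P^`M(i))^`M(i).

(* A formal power series in n commuting variables is an arbitrary family of
   coefficients indexed by the monomials. *)
Record mseries (n : nat) (R : Type) := MSeries { scoeff : 'X_{1..n} -> R }.

Bind Scope ring_scope with mseries.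

Section MSeriesRing.
Context (n : nat) (R : comNzRingType).
Implicit Types f g h : mseries n R.

HB.instance Definition _ := gen_eqMixin (mseries n R).
HB.instance Definition _ := gen_choiceMixin (mseries n R).

Lemma mseriesP f g : scoeff f =1 scoeff g <-> f = g.
Proof.
split=> [|-> //]; case: f g => [f] [g] /= /funext eq_fg.
by congr MSeries.
Qed.

Definition series0 : mseries n R := MSeries (fun=> 0).
Definition series_opp f := MSeries (fun m => - scoeff f m).
Definition series_add f g := MSeries (fun m => scoeff f m + scoeff g m).

Fact series_addA : associative series_add.
Proof. by move=> f g h; apply/mseriesP=> m /=; rewrite addrA. Qed.
Fact series_addC : commutative series_add.
Proof. by move=> f g; apply/mseriesP=> m /=; rewrite addrC. Qed.
Fact series_add0 : left_id series0 series_add.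
Proof. by move=> f; apply/mseriesP=> m /=; rewrite add0r. Qed.
Fact series_addN : left_inverse series0 series_opp series_add.
Proof. by move=> f; apply/mseriesP=> m /=; rewrite addNr. Qed.

HB.instance Definition _ := GRing.isZmodule.Build (mseries n R)
  series_addA series_addC series_add0 series_addN.

Definition series1 : mseries n R := MSeries (fun m => (m == 0%MM)%:R).

(* The bound on the degrees only makes the index type finite: m = a + b
   forces the degrees of a and b to be at most that of m. *)
Definition series_mul f g : mseries n R := MSeries (fun m =>
  \sum_(ab : 'X_{1..n < (mdeg m).+1, (mdeg m).+1} | m == (ab.1 + ab.2)%MM)
    scoeff f ab.1 * scoeff g ab.2).

Definition strunc (d : nat) f : {mpoly R[n]} :=
  \sum_(m : 'X_{1..n < d}) scoeff f m *: 'X_[m].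

Lemma mcoeff_strunc d f m : (mdeg m < d)%N -> (strunc d f)@_m = scoeff f m.
Proof. exact: mcoeff_mpoly. Qed.

Lemma scoeff_mul_mpoly f g (p q : {mpoly R[n]}) m :
    (forall a, (mdeg a <= mdeg m)%N -> p@_a = scoeff f a) ->
    (forall a, (mdeg a <= mdeg m)%N -> q@_a = scoeff g a) ->
  scoeff (series_mul f g) m = (p * q)@_m.
Proof.
move=> eq_pf eq_qg; rewrite mcoeffM /=; apply: eq_bigr => -[a b] _ /=.
by rewrite eq_pf ?eq_qg // -ltnS bmdeg.
Qed.

Lemma mcoeff_struncM d f g m : (mdeg m < d)%N ->
  (strunc d f * strunc d g)@_m = scoeff (series_mul f g) m.
Proof.
by move=> lt_md; symmetry; apply: scoeff_mul_mpoly => a le_am;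
  apply: mcoeff_strunc; apply: leq_ltn_trans lt_md.
Qed.

Fact series_mulA : associative series_mul.
Proof.
move=> f g h; apply/mseriesP=> m; set d := (mdeg m).+1.
have E u a : (mdeg a <= mdeg m)%N -> (strunc d u)@_a = scoeff u a.
  by move=> le_am; apply: mcoeff_strunc.
have EM u v a : (mdeg a <= mdeg m)%N ->
    (strunc d u * strunc d v)@_a = scoeff (series_mul u v) a.
  by move=> le_am; apply: mcoeff_struncM.
rewrite (scoeff_mul_mpoly (E f) (EM g h)).
by rewrite (scoeff_mul_mpoly (EM f g) (E h)) mulrA.
Qed.

Fact series_mulC : commutative series_mul.
Proof.
move=> f g; apply/mseriesP=> m.
by rewrite -(mcoeff_struncM f g (ltnSn _)) mulrC mcoeff_struncM.
Qed.

Fact series_mul1 : left_id series1 series_mul.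
Proof.
move=> f; apply/mseriesP=> m; set d := (mdeg m).+1.
rewrite (@scoeff_mul_mpoly series1 f 1 (strunc d f)) => [|a _|a le_am].
- by rewrite mul1r mcoeff_strunc.
- by rewrite mcoeff1.
exact: mcoeff_strunc.
Qed.

Fact series_mulDl : left_distributive series_mul series_add.
Proof.
move=> f g h; apply/mseriesP=> m /=; rewrite -big_split /=.
by apply: eq_bigr => ab _; rewrite mulrDl.
Qed.

Fact series1_neq0 : series1 != 0.
Proof.
apply/eqP=> /mseriesP/(_ 0%MM)/=; rewrite eqxx => /eqP.
by rewrite oner_eq0.
Qed.

HB.instance Definition _ := GRing.Zmodule_isComNzRing.Build (mseries n R)
  series_mulA series_mulC series_mul1 series_mulDl series1_neq0.

End MSeriesRing.

Definition sderiv (n : nat) (R : comNzRingType) (i : 'I_n) (f : mseries n R) :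
    mseries n R :=
  MSeries (fun m => scoeff f (m + U_(i))%MM *+ (m i).+1).

Definition slaplace (n : nat) (R : comNzRingType) (f : mseries n R) :
    mseries n R :=
  \sum_(i < n) sderiv i (sderiv i f).

(* In characteristic 3, the polynomial P = z_1 has degree 1 and
   Delta P ^ 2 = 2 <> 0, although m = 1 satisfies m >= 1 * (3 - 1) / 2. *)
Lemma mlaplace_sqrX_char3 (k : fieldType) : 3%N \in [pchar k] ->
  msize ('X_ord0 : {mpoly k[1]}) = 2%N /\
  mlaplace (('X_ord0 : {mpoly k[1]}) ^+ 2) != 0.
Proof.
move=> char3; split; first by rewrite msizeX mdeg1.
rewrite /mlaplace big_ord1 expr2 mderivM mderivX mnmE eqxx scale1r.
rewrite (_ : (U_(0%R) - U_(0%R) = 0)%MM); last first.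
  by apply/mnmP=> i; rewrite !mnmE subnn.
rewrite mpolyX0 mul1r mulr1 mderivD mderivX mnmE eqxx scale1r.
rewrite (_ : (U_(0%R) - U_(0%R) = 0)%MM); last first.
  by apply/mnmP=> i; rewrite !mnmE subnn.
rewrite mpolyX0; apply/eqP=> /mpolyP/(_ 0%MM)/eqP; apply/negP.
rewrite mcoeffD mcoeff1 mcoeff0 eqxx -[1 + 1]/(2%:R).
by rewrite -(dvdn_pcharf char3).
Qed.

(* Main.v *)
From HB Require Import structures.
Require Import Defs.
From mathcomp Require Import all_boot all_order all_algebra.
From mathcomp Require Import mpoly.
From mathcomp Require Import zify.

(** In characteristic [p] each partial derivative satisfies [d_i ^ p = 0], so
    by the Frobenius identity for the commuting operators [d_i ^ 2] the Laplace
    operator satisfies [Delta ^ p = \sum_i d_i ^ (2 * p) = 0].  This settles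
    every [m >= p]; for [m = p - 1 >= 1] already [Delta (P ^ p) = 0], since every
    partial derivative kills [p]-th powers.  In part (a) the bound on [m] then
    leaves only [d = 1]: there [P ^ (m + 1)] has degree [m + 1 < 2 * m] as soon
    as [m >= 2], and [m = 1] would force [p = 3].  A coefficient of
    [Delta ^ m (P ^ (m + 1))] involves only finitely many coefficients of [P],
    so power series reduce to polynomials. *)

Set Implicit Arguments.
Unset Strict Implicit.
Unset Printing Implicit Defensive.

Import GRing.Theory Num.Theory.

Local Open Scope ring_scope.

Section CommutingAdditiveOperators.
Context (V : zmodType).
Implicit Types A B : V -> V.

Lemma iter_commute A B a b : (forall x, A (B x) = B (A x)) ->
  forall x, iter a A (iter b B x) = iter b B (iter a A x).
Proof.
move=> cAB x; elim: a => //= a ->.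
by elim: b => //= b <-; rewrite cAB.
Qed.

Lemma iter_addDn (A B : {additive V -> V}) m x :
    (forall y, A (B y) = B (A y)) ->
  iter m (fun y => A y + B y) x =
    \sum_(i < m.+1) iter (m - i) A (iter i B x) *+ 'C(m, i).
Proof.
move=> cAB; elim: m => [|m IH]; first by rewrite big_ord1 bin0.
rewrite iterS IH !raddf_sum -big_split /= [RHS]big_ord_recl /=.
(* Pascal's rule: the first sum comes from the outer [A], the second from the outer [B]. *)
have -> : \sum_(i < m.+1) iter (m.+1 - bump 0 i) A (iter (bump 0 i) B x)
      *+ 'C(m.+1, bump 0 i) =
    \sum_(i < m.+1) iter (m - i) A (iter i.+1 B x) *+ 'C(m, i.+1) +
    \sum_(i < m.+1) B (iter (m - i) A (iter i B x) *+ 'C(m, i)).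
  rewrite -big_split /=; apply: eq_bigr => i _.
  rewrite /bump add1n subSS binS mulrnDr raddfMn /=; congr (_ + _ *+ _).
  by rewrite (iter_commute (m - i) 1 cAB).
rewrite big_split /= addrA; congr (_ + _).
rewrite big_ord_recl big_ord_recr /= (bin_small (ltnSn m)) mulr0n addr0 !bin0 !subn0.
congr (_ + _); apply: eq_bigr => i _.
by rewrite raddfMn /bump add1n -(subnSK (ltn_ord i)).
Qed.

(** Frobenius identity: [p] divides every inner binomial coefficient of the expansion. *)
Lemma iter_addD_pchar (A B : {additive V -> V}) p x : prime p ->
    (forall y : V, y *+ p = 0) -> (forall y, A (B y) = B (A y)) ->
  iter p (fun y => A y + B y) x = iter p A x + iter p B x.
Proof.
move=> p_pr Vp cAB; rewrite iter_addDn // big_ord_recr /= subnn binn.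
case: p p_pr Vp => // p p_pr Vp; rewrite big_ord_recl bin0.
rewrite big1 ?addr0 // => i _.
have /dvdnP[c ->] : (p.+1 %| 'C(p.+1, bump 0 i))%N.
  by apply: prime_dvd_bin; rewrite // /bump; have := ltn_ord i; lia.
by rewrite mulrnA Vp.
Qed.

Lemma iter_sum_pchar (I : eqType) (D : I -> {additive V -> V}) (r : seq I) p x :
    prime p -> (forall y : V, y *+ p = 0) ->
    (forall i j y, D i (D j y) = D j (D i y)) ->
  iter p (fun y => \sum_(i <- r) D i y) x = \sum_(i <- r) iter p (D i) x.
Proof.
move=> p_pr Vp cD; elim: r x => [|i r IH] x.
  (* The empty sum is the zero operator, whose [p]-th iterate is zero only because [p > 0]. *)
  rewrite big_nil; case: p p_pr {Vp} => // p _.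
  by rewrite iterS big_nil.
pose S y := \sum_(j <- r) D j y.
have S_add : nmod_morphism S.
  split=> [|y z]; rewrite /S; first by rewrite big1 // => j _; rewrite raddf0.
  by rewrite -big_split; apply: eq_bigr => j _; rewrite raddfD.
(* The tail sum is bundled as a single additive operator, so that the two-operator identity applies
   to [D i] and [SA]. *)
pose SA : {additive V -> V} :=
  HB.pack S (GRing.isNmodMorphism.Build V V S S_add).
have cS y : D i (SA y) = SA (D i y).
  by rewrite raddf_sum; apply: eq_bigr => j _; rewrite cD.
rewrite big_cons -IH -(iter_addD_pchar _ p_pr Vp cS).
by apply: eq_iter => y; rewrite big_cons.
Qed.

End CommutingAdditiveOperators.

Section Laplacian.
Context (n : nat) (R : comNzRingType).
Implicit Types P Q : {mpoly R[n]}.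

Lemma mcoeff_mlaplace P m : (mlaplace P)@_m =
  \sum_(i < n) P@_(m + U_(i) + U_(i)) *+ ((m + U_(i))%MM i).+1 *+ (m i).+1.
Proof.
rewrite /mlaplace raddf_sum; apply: eq_bigr => i _ /=.
by rewrite !mcoeff_mderiv.
Qed.

Lemma scoeff_slaplace (f : mseries n R) m : scoeff (slaplace f) m =
  \sum_(i < n)
    scoeff f (m + U_(i) + U_(i))%MM *+ ((m + U_(i))%MM i).+1 *+ (m i).+1.
Proof.
by rewrite /slaplace (big_morph (fun g => scoeff g m) (id1 := 0) (op1 := +%R)) //.
Qed.

Lemma mlaplace0 : mlaplace (0 : {mpoly R[n]}) = 0.
Proof. by rewrite /mlaplace big1 // => i _; rewrite !mderiv0. Qed.

Lemma iter_mlaplace_eq0W a b P : (a <= b)%N ->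
  iter a (@mlaplace n R) P = 0 -> iter b (@mlaplace n R) P = 0.
Proof.
move=> /subnK <- E; rewrite iterD E.
by elim: (b - a)%N => //= c ->; rewrite mlaplace0.
Qed.

Lemma iter_mlaplace_msize P a :
  (msize P <= a.*2)%N -> iter a (@mlaplace n R) P = 0.
Proof.
move=> leP; apply/mpolyP => m; rewrite mcoeff0.
(* Generalized for the induction: each Laplacian reads coefficients at monomials two degrees above
   [m]. *)
have {leP} : (msize P <= a.*2 + mdeg m)%N by lia.
elim: a m => [|a IH] m leP /=.
  by apply: memN_msupp_eq0; apply: msize_mdeg_ge.
rewrite mcoeff_mlaplace big1 // => i _.
by rewrite IH ?mul0rn // !mdegD mdeg1; lia.
Qed.

Lemma mderivXn i P k : (P ^+ k)^`M(i) = P ^+ k.-1 * P^`M(i) *+ k.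
Proof.
elim: k => [|k IH]; first by rewrite expr0 -mpolyC1 mderivC mulr0n.
rewrite exprS mderivM IH; case: k {IH} => [|k] /=.
  by rewrite !expr0 mulr1 mulr0n mulr0 addr0 mul1r.
by rewrite mulrnAr mulrA -exprS mulrC -mulrS.
Qed.

Context (p : nat) (char_p : p \in [pchar R]).

Lemma mpoly_mulrn_pchar P : P *+ p = 0.
Proof. by rewrite -scaler_nat (pcharf0 char_p) scale0r. Qed.

(** Differentiating [p] times multiplies a coefficient by a falling factorial of length [p], a
    multiple of [p]! and hence of [p]. *)
Lemma iter_mderiv_pchar i P : iter p (mderiv i) P = 0.
Proof.
have p_pr := pcharf_prime char_p.
rewrite -mderivn_iter mderivnE big1 // => m _.
have /dvdnP[c ->] : (p %| (m i) ^_ p)%N.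
  by rewrite -bin_ffact dvdn_mull // dvdn_fact // prime_gt0 /=.
by rewrite natrM (pcharf0 char_p) mulr0 mul0r scale0r.
Qed.

Lemma iter_mlaplace_pchar P : iter p (@mlaplace n R) P = 0.
Proof.
rewrite (iter_sum_pchar (D := fun i => mderiv i \o mderiv i)) //.
- rewrite big1 // => i _.
  have -> Q b : iter b (mderiv i \o mderiv i) Q =
      iter b (mderiv i) (iter b (mderiv i) Q).
    elim: b => //= b ->; congr (_ ^`M(_)).
    by rewrite -iterSr.
  by rewrite !iter_mderiv_pchar.
- exact: pcharf_prime char_p.
- exact: mpoly_mulrn_pchar.
by move=> i j Q /=; rewrite !(mderiv_comm i j).
Qed.

Lemma mlaplace_exp_pchar P : mlaplace (P ^+ p) = 0.
Proof.
rewrite /mlaplace big1 // => i _.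
by rewrite mderivXn mpoly_mulrn_pchar mderiv0.
Qed.

Lemma iter_mlaplace_expS P m :
  (p.-1 <= m)%N -> iter m (@mlaplace n R) (P ^+ m.+1) = 0.
Proof.
have p_gt1 := prime_gt1 (pcharf_prime char_p).
rewrite leq_eqVlt => /predU1P[<-|ltpm].
  rewrite prednK ?(ltnW p_gt1) //.
  by apply: (@iter_mlaplace_eq0W 1); [lia|exact: mlaplace_exp_pchar].
by apply: (@iter_mlaplace_eq0W p); [lia|exact: iter_mlaplace_pchar].
Qed.

End Laplacian.

Section Truncation.
Context (n : nat) (R : comNzRingType).
Implicit Types (f : mseries n R) (P : {mpoly R[n]}).

(** Terms of [P] of degree at least [d] are left free, so powers of a truncation need not be
    truncated again. *)
Definition agree d f P := forall m, (mdeg m < d)%N -> P@_m = scoeff f m.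

Lemma agree_exp d f P k : agree d f P -> agree d (f ^+ k) (P ^+ k).
Proof.
move=> fP; elim: k => [|k IH] m ltmd; first by rewrite !expr0 mcoeff1.
rewrite !exprS; symmetry; apply: scoeff_mul_mpoly => a leam.
  exact: fP (leq_ltn_trans leam ltmd).
exact: IH (leq_ltn_trans leam ltmd).
Qed.

(** Each Laplacian costs two degrees of precision. *)
Lemma agree_iter_laplace d f P k : agree (d + k.*2) f P ->
  agree d (iter k (@slaplace n R) f) (iter k (@mlaplace n R) P).
Proof.
elim: k d => [|k IH] d fP m ltmd; first by apply: fP; rewrite addn0.
rewrite /= mcoeff_mlaplace scoeff_slaplace; apply: eq_bigr => i _.
rewrite (IH d.+2); first by [].
- by rewrite addSnnS addSnnS -doubleS.
by rewrite !mdegD mdeg1; lia.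
Qed.

End Truncation.

Theorem proposition5p1 (k : fieldType) (p : nat) (char_p : p \in [pchar k])
    (n : nat) :
  (forall (d : nat) (P : {mpoly k[n]}),
     (1 <= d)%N -> msize P = d.+1 ->
     forall m : nat, (d * (p - 1))%:R / 2%:R <= m%:R :> rat ->
       (d, p, m) <> (1%N, 3%N, 1%N) ->
       iter m (@mlaplace n k) (P ^+ m.+1) = 0)
  /\
  (forall P : mseries n k,
     (forall m : nat, (1 <= m)%N -> iter m (@slaplace n k) (P ^+ m) = 0) ->
     forall m : nat, (p - 1 <= m)%N ->
       iter m (@slaplace n k) (P ^+ m.+1) = 0).
Proof.
have p_gt1 := prime_gt1 (pcharf_prime char_p).
split=> [d P d_gt0 sizeP m|P _ m le_pm].
  rewrite ler_pdivrMr ?ltr0n // -natrM ler_nat => le_dpm not_exc.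
  have [le_pm|lt_mp] := leqP p.-1 m;
    first exact: iter_mlaplace_expS char_p _ _ _.
  (* If [d >= 2], then [d * (p - 1) <= 2 * m] would give [p - 1 <= m]. *)
  have d1 : d = 1%N by nia.
  apply: iter_mlaplace_msize.
  have P_neq0 : P != 0 by rewrite -msize_poly_eq0 sizeP.
  have -> : msize (P ^+ m.+1) = m.+2.
    elim: m.+1 => [|a IH]; first by rewrite expr0 msize1.
    by rewrite exprS msizeM ?expf_neq0 // IH sizeP d1.
  (* For [m = 1], the bounds [1 < p - 1 <= 2] force [p = 3], the excluded triple. *)
  have : m <> 1%N.
    by move=> m1; apply: not_exc; rewrite d1 m1; congr (_, _, _); lia.
  by lia.
apply/mseriesP => a.
(* The coefficient at [a] must survive [m] Laplacians, hence the extra [2 * m] degrees. *)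
have trP : agree ((mdeg a).+1 + m.*2) P (strunc ((mdeg a).+1 + m.*2) P).
  by move=> b ltb; apply: mcoeff_strunc.
rewrite -(agree_iter_laplace (agree_exp m.+1 trP)) //.
by rewrite (iter_mlaplace_expS char_p) ?mcoeff0 // -subn1.
Qed.
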